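(* For an input $X\in\mathbb{R}^{N\times D}$ let $Q=XW_Q$, $K=XW_K$, $V=XW_V$, where $W_Q,W_K,W_V$ are weight (projection) matrices, and let the output of the attention replacement used by Castling-ViT at inference be $$O=\frac1\pi\,Q\,\left(K^TV\right)+\left(\tfrac12 I+M_{DW}\right)V ,$$ where $I$ is the identity and $M_{DW}$ represents a learnt depth-wise convolution (a fast linear transformation). Then the first term $\frac1\pi Q(K^TV)$ is a degree-3 homogeneous polynomial in the input $X$, and the second term $\left(\tfrac12 I+M_{DW}\right)V$ is a linear function of $X$. Consequently the output $O$ is a degree-3 polynomial in $X$ that can be computed rapidly (i.e., in linear time), and the Castling-ViT attention replacement is therefore an instance of the PADRe framework.
   Context: $N$ is the number of tokens and $D$ the embedding (channel) dimension. A matrix-valued function of $X$ is called a (homogeneous) polynomial or a linear function of $X$ when each of its entries is one in the entries of $X$. The depth-wise convolution $M_{DW}$ is a linear operator acting on each channel (column) of $V$ by a convolution, with structure that allows it to be applied fast. The PADRe (Polynomial Attention Drop-in Replacement) framework consists of the schemes described as follows: each element of the output tensor is a polynomial function of the elements of the input tensor, the coefficients of which are polynomial functions of the parameters (weights); further, this dependency is such that the coefficients and the output itself may be computed efficiently (e.g., in linear time). *)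

(* Defs.v *)
From HB Require Import structures.
From mathcomp Require Import all_boot all_order all_algebra.
From mathcomp Require Import mpoly.
From mathcomp Require Import reals trigo.

Set Implicit Arguments.
Unset Strict Implicit.
Unset Printing Implicit Defensive.

Import GRing.Theory.

Local Open Scope ring_scope.

(* The entries of X : 'M_(N, D) are the variables: variable [mxvec_index n a]
   stands for X n a. *)

Definition represents (R : comNzRingType) (N D : nat)
    (p : {mpoly R[N * D]}) (f : 'M[R]_(N, D) -> R) : Prop :=
  forall X : 'M[R]_(N, D), f X = p.@[mxvec X 0].

Definition homog_poly_fun (R : comNzRingType) (d N D e : nat)
    (f : 'M[R]_(N, D) -> 'M[R]_(N, e)) : Prop :=
  forall i j, exists2 p : {mpoly R[N * D]},
    p \is d.-homog & represents p (fun X => f X i j).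

(* [msize p] is one more than the total degree of p (and 0 if p = 0). *)
Definition poly_fun_deg_le (R : comNzRingType) (d N D e : nat)
    (f : 'M[R]_(N, D) -> 'M[R]_(N, e)) : Prop :=
  forall i j, exists2 p : {mpoly R[N * D]},
    (msize p <= d.+1)%N & represents p (fun X => f X i j).

Definition poly_fun_deg_eq (R : comNzRingType) (d N D e : nat)
    (f : 'M[R]_(N, D) -> 'M[R]_(N, e)) : Prop :=
  forall i j, exists2 p : {mpoly R[N * D]},
    msize p = d.+1 & represents p (fun X => f X i j).

Definition linear_fun (R : comNzRingType) (N D e : nat)
    (f : 'M[R]_(N, D) -> 'M[R]_(N, e)) : Prop :=
  forall i j, scalar (fun X => f X i j).

(* Computations are arithmetic straight-line programs. The memory initially
   holds the inputs; every instruction appends one value, a constant or the sum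
   or product of two earlier cells. Running time is the number of
   instructions, constants included. *)

Inductive instr (R : Type) : Type :=
  | Const of R
  | Add of nat & nat
  | Mul of nat & nat.

Definition exec (R : pzRingType) (mem : seq R) (c : instr R) : seq R :=
  rcons mem
    match c with
    | Const a => a
    | Add i j => mem`_i + mem`_j
    | Mul i j => mem`_i * mem`_j
    end.

Definition run (R : pzRingType) (prog : seq (instr R)) (mem : seq R) : seq R :=
  foldl (@exec R) mem prog.

Definition row_seq (R : Type) (n : nat) (v : 'rV[R]_n) : seq R :=
  [seq v ord0 i | i <- enum 'I_n].

(* For every N, a map from p N weights and N tokens with D channels to N tokens
   with e channels. *)

Definition scheme (R : Type) (p : nat -> nat) (D e : nat) : Type :=
  forall N : nat, 'rV[R]_(p N) -> 'M[R]_(N, D) -> 'M[R]_(N, e).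

(* Polynomials in the entries of X whose coefficients are polynomials in the
   weights, one for each entry of the output. *)
Definition poly_scheme (R : comNzRingType) (p : nat -> nat) (D e : nat) : Type :=
  forall N : nat, 'I_N -> 'I_e -> {mpoly {mpoly R[p N]}[N * D]}.

Definition at_weights (R : comNzRingType) (q n : nat) (w : 'rV[R]_q)
    (P : {mpoly {mpoly R[q]}[n]}) : {mpoly R[n]} :=
  map_mpoly (meval (w 0)) P.

(* One program with O(N) instructions evaluates the whole output, both the
   weights and the entries of X being inputs of that program. *)
Definition output_linear_time (R : comNzRingType) (p : nat -> nat) (D e : nat)
    (F : scheme R p D e) : Prop :=
  exists c : nat, forall N : nat, exists2 prog : seq (instr R),
    (size prog <= c * N)%N &
    exists out : 'I_N -> 'I_e -> nat, forall w X i j,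
      (run prog (row_seq (row_mx w (mxvec X))))`_(out i j) = F N w X i j.

(* One program with O(N) instructions evaluates, from the weights, all the
   coefficients of all the entries of the output. There may be more than O(N)
   monomials overall, so a cell may hold the coefficient of several of them. *)
Definition coefs_linear_time (R : comNzRingType) (p : nat -> nat) (D e : nat)
    (A : poly_scheme R p D e) : Prop :=
  exists c : nat, forall N : nat, exists2 prog : seq (instr R),
    (size prog <= c * N)%N &
    forall i j (m : 'X_{1..N * D}), m \in msupp (A N i j) ->
      exists cell : nat, forall w : 'rV[R]_(p N),
        (run prog (row_seq w))`_cell = ((A N i j)@_m).@[w 0].

Definition PADRe (R : comNzRingType) (p : nat -> nat) (D e : nat)
    (F : scheme R p D e) : Prop :=
  exists A : poly_scheme R p D e,
    [/\ forall N w i j,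
          represents (at_weights w (A N i j)) (fun X => F N w X i j),
        coefs_linear_time A
      & output_linear_time F].

(* Token n sits at the point [pos n] of an abelian group G: int for a
   sequence, int * int for an image, etc. Channel j of V, extended by zero
   outside the positions of the tokens, is convolved with the kernel taking
   value [kern t j] at the point [off t] of G, and the result is restricted to
   the positions of the tokens. *)
Definition dwconv (R : comNzRingType) (G : zmodType) (N s e : nat)
    (pos : 'I_N -> G) (off : 'I_s -> G) (kern : 'M[R]_(s, e))
    (V : 'M[R]_(N, e)) : 'M[R]_(N, e) :=
  \matrix_(n < N, j < e)
    \sum_(t < s) kern t j * \sum_(m < N | pos m == pos n - off t) V m j.

Definition castling_attn (R : realType) (N D dk dv : nat)
    (WQ WK : 'M[R]_(D, dk)) (WV : 'M[R]_(D, dv))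
    (X : 'M[R]_(N, D)) : 'M[R]_(N, dv) :=
  let Q := X *m WQ in let K := X *m WK in let V := X *m WV in
  pi^-1 *: (Q *m (K^T *m V)).

Definition castling_conv (R : realType) (G : zmodType) (N D dv s : nat)
    (pos : 'I_N -> G) (off : 'I_s -> G)
    (WV : 'M[R]_(D, dv)) (kern : 'M[R]_(s, dv))
    (X : 'M[R]_(N, D)) : 'M[R]_(N, dv) :=
  let V := X *m WV in
  (2^-1)%:M *m V + dwconv pos off kern V.

Definition castling (R : realType) (G : zmodType) (N D dk dv s : nat)
    (pos : 'I_N -> G) (off : 'I_s -> G)
    (WQ WK : 'M[R]_(D, dk)) (WV : 'M[R]_(D, dv)) (kern : 'M[R]_(s, dv))
    (X : 'M[R]_(N, D)) : 'M[R]_(N, dv) :=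
  castling_attn WQ WK WV X + castling_conv pos off WV kern X.

Definition castling_nweights (D dk dv s : nat) : nat :=
  D * dk + (D * dk + (D * dv + s * dv)).

(* The weights are the entries of W_Q, W_K, W_V and of the kernel, in this
   order. *)
Definition castling_scheme (R : realType) (G : zmodType) (D dk dv s : nat)
    (pos : forall N, 'I_N -> G) (off : 'I_s -> G) :
    scheme R (fun=> castling_nweights D dk dv s) D dv :=
  fun N (w : 'rV[R]_(D * dk + (D * dk + (D * dv + s * dv)))) X =>
    castling (pos N) off
      (vec_mx (lsubmx w))
      (vec_mx (lsubmx (rsubmx w)))
      (vec_mx (lsubmx (rsubmx (rsubmx w))))
      (vec_mx (rsubmx (rsubmx (rsubmx w))))
      X.

(* Main.v *)
Require Import Defs.
From HB Require Import structures.
From mathcomp Require Import all_boot all_order all_algebra.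
From mathcomp Require Import mpoly.
From mathcomp Require Import ring zify.
From mathcomp Require Import reals trigo.
Import Order.TTheory GRing.Theory Num.Theory.
Local Open Scope ring_scope.

Set Implicit Arguments.
Unset Strict Implicit.
Unset Printing Implicit Defensive.

(* O(N) instructions compute Q, K and V, then the dk * dv entries of K^T V at
   cost O(N) each, then every entry of O at constant cost: as tokens have
   distinct positions, a tap of the convolution meets at most one token.

   The coefficients of O are computed at a cost independent of N. Written over
   the monomials X_ia X_nb X_nc (cubic part) and X_nc (linear part), each entry
   of O has coefficients indexed by channels and taps only, and once these are
   fixed distinct tokens n give distinct monomials. Hence the coefficient of any
   monomial, in any entry, for any N, is a subsum of one of finitely many fixed
   sums of polynomials in the weights. *)

(** * Straight-line programs and the cost of sums, products and families *)

Section Programs.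

Variables (R : comNzRingType) (T : Type) (n0 : nat) (mem : T -> seq R).
Hypothesis size_mem : forall t, size (mem t) = n0.

Implicit Types (prog q r : seq (instr R)) (f g : T -> R) (k l : nat).

Lemma size_run prog (m : seq R) : size (run prog m) = (size m + size prog)%N.
Proof.
elim: prog m => [|c prog IH] m /=; first by rewrite addn0.
by rewrite /run /= -/(run _ _) IH size_rcons addSnnS.
Qed.

Lemma run_cat prog q (m : seq R) : run (prog ++ q) m = run q (run prog m).
Proof. exact: foldl_cat. Qed.

Lemma nth_run prog (m : seq R) i : (i < size m)%N -> (run prog m)`_i = m`_i.
Proof.
elim: prog m => // c prog IH m lt_i; rewrite /run /= -/(run _ _) IH.
  by rewrite nth_rcons lt_i.
by rewrite size_rcons ltnW.
Qed.

(** The cell does not depend on [t], so one program serves all inputs. The bound matters: past the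
    end of memory [nth] returns 0, and later instructions could change what is read there. *)
Definition computed prog f : Prop :=
  exists2 cell, (cell < n0 + size prog)%N &
    forall t, (run prog (mem t))`_cell = f t.

(* The quantification over the instructions [q] executed after [prog] is what
   lets several such computations be appended one after the other. *)
Definition computable_within prog k f : Prop :=
  forall q, exists2 r, (size r <= k)%N & computed (prog ++ q ++ r) f.

Lemma computed_cat prog q f : computed prog f -> computed (prog ++ q) f.
Proof.
case=> i lt_i fE; exists i => [|t].
  by rewrite size_cat addnA ltn_addr.
by rewrite run_cat nth_run ?fE // size_run size_mem.
Qed.

(** The appended value lands in cell [n0 + size prog], the same for every [t] because all initial
    memories have size [n0]. *)
Lemma computed_rcons prog c h :
    (forall t, exec (run prog (mem t)) c = rcons (run prog (mem t)) (h t)) ->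
  computed (rcons prog c) h.
Proof.
move=> cE; exists (n0 + size prog)%N => [|t].
  by rewrite size_rcons addnS.
rewrite -cats1 run_cat /run /= -/(run _ _) cE nth_rcons.
by rewrite size_run size_mem ltnn eqxx.
Qed.

Lemma within_eq prog k f g :
  f =1 g -> computable_within prog k f -> computable_within prog k g.
Proof.
move=> fg fP q; have [r le_r [i lt_i fE]] := fP q; exists r => //.
by exists i => // t; rewrite fE fg.
Qed.

Lemma within_leq prog k l f :
  (k <= l)%N -> computable_within prog k f -> computable_within prog l f.
Proof.
move=> le_kl fP q; have [r le_r rP] := fP q.
by exists r => //; apply: leq_trans le_kl.
Qed.

(** A stored value is reused for free: inputs, and later the entries of Q, K, V and K^T V, enter
    further computations at cost 0. *)
Lemma within_computed prog f : computed prog f -> computable_within prog 0 f.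
Proof. by move=> fP q; exists [::]; rewrite ?cats0 //; apply: computed_cat. Qed.

Lemma within_const prog a : computable_within prog 1 (fun=> a).
Proof.
move=> q; exists [:: Const a] => //.
by rewrite catA cats1; apply: computed_rcons.
Qed.

(** [g] is computed after [q ++ r1], which the quantification over [q] in [computable_within]
    permits, and [f] keeps its cell. *)
Lemma within_pair prog k l f g :
    computable_within prog k f -> computable_within prog l g ->
  forall q, exists2 r, (size r <= k + l)%N &
    computed (prog ++ q ++ r) f /\ computed (prog ++ q ++ r) g.
Proof.
move=> fP gP q; have [r1 le_r1 f1] := fP q; have [r2 le_r2 g2] := gP (q ++ r1).
exists (r1 ++ r2); first by rewrite size_cat leq_add.
rewrite !catA in f1 g2 *; split=> //; exact: computed_cat.
Qed.

Lemma within_add prog k l f g :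
    computable_within prog k f -> computable_within prog l g ->
  computable_within prog (k + l).+1 (fun t => f t + g t).
Proof.
move=> fP gP q; have [r le_r [[i _ fE] [j _ gE]]] := within_pair fP gP q.
exists (rcons r (Add R i j)); first by rewrite size_rcons.
rewrite -!rcons_cat; apply: computed_rcons => t.
by rewrite /exec fE gE.
Qed.

Lemma within_mul prog k l f g :
    computable_within prog k f -> computable_within prog l g ->
  computable_within prog (k + l).+1 (fun t => f t * g t).
Proof.
move=> fP gP q; have [r le_r [[i _ fE] [j _ gE]]] := within_pair fP gP q.
exists (rcons r (Mul R i j)); first by rewrite size_rcons.
rewrite -!rcons_cat; apply: computed_rcons => t.
by rewrite /exec fE gE.
Qed.

(** Each term costs [k] and one addition; the extra instruction is the constant 0 that starts the
    sum. *)
Lemma within_sum prog k (I : finType) (P : pred I) (F : I -> T -> R) :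
    (forall i, P i -> computable_within prog k (F i)) ->
  computable_within prog (#|P| * k.+1).+1 (fun t => \sum_(i | P i) F i t).
Proof.
move=> FP; rewrite cardE.
apply: (within_eq (f := fun t => \sum_(i <- enum P) F i t)) => [t|].
  by rewrite big_enum.
have: {subset enum P <= P} by move=> i; rewrite mem_enum.
elim: (enum P) => [_|i s IH sP] /=.
  by apply: within_eq (within_const _ 0) => t; rewrite big_nil.
apply: (within_eq (f := fun t => F i t + \sum_(j <- s) F j t)) => [t|].
  by rewrite big_cons.
rewrite mulSn addSn -addnS; apply: within_add; first by apply/FP/sP/mem_head.
by apply: IH => j js; apply: sP; rewrite inE js orbT.
Qed.

Lemma within_sum_ord prog k n (F : 'I_n -> T -> R) :
    (forall i, computable_within prog k (F i)) ->
  computable_within prog (n * k.+1).+1 (fun t => \sum_i F i t).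
Proof.
move=> FP; have := within_sum (P := predT) (fun i _ => FP i).
by rewrite card_ord.
Qed.

(** Members are computed one after another, so their costs add up and all the values end in one
    memory. *)
Lemma within_family prog k (I : finType) (F : I -> T -> R) :
    (forall i, computable_within prog k (F i)) ->
  exists2 q, (size q <= #|I| * k)%N & forall i, computed (prog ++ q) (F i).
Proof.
move=> FP; rewrite cardE.
suff [q le_q qF]: exists2 q, (size q <= size (enum I) * k)%N &
    forall i, i \in enum I -> computed (prog ++ q) (F i).
  by exists q => // i; apply: qF; rewrite mem_enum.
elim: (enum I) => [|i s [q le_q qF]]; first by exists [::].
have [r le_r rF] := FP i q.
exists (q ++ r) => [|j]; first by rewrite size_cat mulSn addnC leq_add.
rewrite inE => /predU1P[-> //|js]; rewrite catA; exact/computed_cat/qF.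
Qed.

End Programs.

(** * Evaluating fixed polynomials by programs *)

Lemma nth_row_seq (R : nzRingType) n (v : 'rV[R]_n) (k : 'I_n) :
  (row_seq v)`_k = v 0 k.
Proof.
by rewrite (nth_map k) ?nth_ord_enum // size_enum_ord.
Qed.

Lemma size_row_seq (R : Type) n (v : 'rV[R]_n) : size (row_seq v) = n.
Proof. by rewrite size_map size_enum_ord. Qed.

Lemma computed_input (R : comNzRingType) (T : Type) n (v : T -> 'rV[R]_n) k :
  computed n (fun t => row_seq (v t)) [::] (fun t => v t 0 k).
Proof. by exists k => [|t]; rewrite ?addn0 // nth_row_seq. Qed.

Lemma within_meval (R : comNzRingType) n (p : {mpoly R[n]}) :
  exists k, computable_within n (@row_seq R n) [::] k (fun w => p.@[w 0]).
Proof.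
have size_mem := @size_row_seq R n.
elim/mpolyind: p => [|c m p _ _ [k pP]].
  exists 1%N; apply: within_eq (within_const size_mem _ 0) => w.
  by rewrite meval0.
have [l mP]: exists l, computable_within n (@row_seq R n) [::] l
    (fun w => ('X_[R, m]).@[w 0]).
  suff [l mP]: exists l, computable_within n (@row_seq R n) [::] l
      (fun w => \prod_(i < n) w 0 i ^+ m i).
    by exists l; apply: within_eq mP => w; rewrite mevalX.
  elim: (index_enum _) => [|i s [l sP]].
    exists 1%N; apply: within_eq (within_const size_mem _ 1) => w.
    by rewrite big_nil.
  have [j iP]: exists j, computable_within n (@row_seq R n) [::] j
      (fun w => w 0 i ^+ m i).
    elim: (m i) => [|d [j jP]]; first by exists 1%N; apply: within_const.
    exists (0 + j).+1; apply: (within_eq (f := fun w : 'rV_n => w 0 i * w 0 i ^+ d)).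
      by move=> w; rewrite exprS.
    apply: within_mul => //; apply: within_computed => //; exact: computed_input.
  exists (j + l).+1; apply: within_eq (within_mul size_mem iP sP) => w.
  by rewrite big_cons.
exists ((1 + l).+1 + k).+1.
have := within_add size_mem (within_mul size_mem (within_const size_mem _ c) mP) pP.
by apply: within_eq => w; rewrite mevalD mevalZ.
Qed.

(** The program depends on the family alone: for a family chosen independently of N its length is
    O(1). *)
Lemma finite_family_computable (R : comNzRingType) n (I : finType)
    (p : I -> {mpoly R[n]}) :
  exists prog : seq (instr R), forall i, exists cell, forall w : 'rV[R]_n,
    (run prog (row_seq w))`_cell = (p i).@[w 0].
Proof.
have [k kP] := fin_all_exists (fun i => within_meval (p i)).
(* The maximum of the individual costs serves as the common bound required by [within_family]. *)
have /(within_family (@size_row_seq R n)) [q _ qP] : forall i,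
    computable_within n (@row_seq R n) [::] (\max_j k j) (fun w => (p i).@[w 0]).
  by move=> i; apply: within_leq (leq_bigmax i) (kP i).
by exists q => i; have [cell _ cellE] := qP i; exists cell.
Qed.

(** * Sums of monomials whose coefficients are shared between tokens *)

Lemma mxvec_index_inj N D (i i' : 'I_N) (a a' : 'I_D) :
  mxvec_index i a = mxvec_index i' a' -> i = i' /\ a = a'.
Proof. by move/cast_ord_inj/enum_rank_inj; case. Qed.

Section SumsOfMonomials.

Variables (n : nat) (U J : finType).

(** [U] will index channels and taps, [J] the tokens. Coefficients depend on [U] only, which keeps
    their number independent of N; different [u] may give the same monomial. *)
Definition sum_monomials (S : comNzRingType) (C : U -> S) (sel : U -> pred J)
    (mon : U -> J -> 'X_{1..n}) : {mpoly S[n]} :=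
  \sum_u C u *: \sum_(x | sel u x) 'X_[mon u x].

Variables (sel : U -> pred J) (mon : U -> J -> 'X_{1..n}).

Lemma map_sum_monomials (S S' : comNzRingType) (f : {rmorphism S -> S'})
    (C : U -> S) :
  map_mpoly f (sum_monomials C sel mon) = sum_monomials (f \o C) sel mon.
Proof.
rewrite /sum_monomials rmorph_sum; apply: eq_bigr => u _ /=.
rewrite map_mpolyZ rmorph_sum; congr (_ *: _).
by apply: eq_bigr => x _; apply: map_mpolyX.
Qed.

Lemma eq_sum_monomials (S : comNzRingType) (C C' : U -> S) :
  C =1 C' -> sum_monomials C sel mon = sum_monomials C' sel mon.
Proof. by move=> CC'; apply: eq_bigr => u _; rewrite CC'. Qed.

Lemma meval_sum_monomials (S : comNzRingType) (C : U -> S) v :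
  (sum_monomials C sel mon).@[v] =
  \sum_u C u * \sum_(x | sel u x) ('X_[S, mon u x]).@[v].
Proof.
rewrite /sum_monomials raddf_sum /=; apply: eq_bigr => u _.
by rewrite mevalZ raddf_sum.
Qed.

Lemma sum_monomials_homog (S : comNzRingType) (C : U -> S) d :
  (forall u x, mdeg (mon u x) = d) -> sum_monomials C sel mon \is d.-homog.
Proof.
move=> deg_mon; apply: rpred_sum => u _; apply: rpredZ.
by apply: rpred_sum => x _; rewrite dhomogX; apply/eqP/deg_mon.
Qed.

(* For given [u], at most one [x] yields the monomial [m], so the coefficient
   of [m] is a subsum of the [C u]. *)
Lemma mcoeff_sum_monomials (S : comNzRingType) (C : U -> S) m :
    (forall u, injective (mon u)) ->
  exists e : {ffun U -> bool}, (sum_monomials C sel mon)@_m = \sum_(u | e u) C u.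
Proof.
move=> mon_inj.
exists [ffun u => [exists (x | sel u x), mon u x == m]].
rewrite /sum_monomials raddf_sum [RHS]big_mkcond /=; apply: eq_bigr => u _.
rewrite ffunE mcoeffZ raddf_sum /=.
case: existsP => [[x0 /andP[sel0 /eqP mon0]]|no_x].
  rewrite (bigD1 x0) //= mcoeffX mon0 eqxx big1 ?addr0 ?mulr1 // => x /andP[_ ne_x].
  by rewrite mcoeffX -mon0 (inj_eq (mon_inj u)) (negbTE ne_x).
rewrite big1 ?mulr0 // => x sel_x; rewrite mcoeffX.
by case: eqP => // /eqP mon_x; case: no_x; exists x; rewrite sel_x.
Qed.

End SumsOfMonomials.

(** * The cubic and linear parts of the output as explicit polynomials *)

Section CastlingPolynomials.

Variables (G : zmodType) (N D dk dv s : nat) (pos : 'I_N -> G) (off : 'I_s -> G).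

(** The triple [u] holds the channels of X read through Q, K and V. The ring [S] is abstract so that
    weights may be numbers or variables. *)
Definition attn_coef (S : comNzRingType) (p : S) (WQ WK : 'M[S]_(D, dk))
    (WV : 'M[S]_(D, dv)) (j : 'I_dv) (u : 'I_D * 'I_D * 'I_D) : S :=
  p * \sum_k WQ u.1.1 k * WK u.1.2 k * WV u.2 j.

Definition attn_monomial (i : 'I_N) (u : 'I_D * 'I_D * 'I_D) (n : 'I_N) :
    'X_{1..N * D} :=
  (U_(mxvec_index i u.1.1) + (U_(mxvec_index n u.1.2) + U_(mxvec_index n u.2)))%MM.

Definition attn_poly (S : comNzRingType) (p : S) (WQ WK : 'M[S]_(D, dk))
    (WV : 'M[S]_(D, dv)) (i : 'I_N) (j : 'I_dv) : {mpoly S[N * D]} :=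
  sum_monomials (attn_coef p WQ WK WV j) (fun _ _ => true) (attn_monomial i).

(* [None] stands for the scalar operator [h%:M], [Some t] for the [t]-th tap of
   the convolution. *)
Definition conv_coef (S : comNzRingType) (h : S) (WV : 'M[S]_(D, dv))
    (kern : 'M[S]_(s, dv)) (j : 'I_dv) (u : option 'I_s * 'I_D) : S :=
  (if u.1 is Some t then kern t j else h) * WV u.2 j.

Definition conv_sel (i : 'I_N) (u : option 'I_s * 'I_D) (n : 'I_N) : bool :=
  if u.1 is Some t then pos n == pos i - off t else n == i.

Definition conv_monomial (u : option 'I_s * 'I_D) (n : 'I_N) : 'X_{1..N * D} :=
  U_(mxvec_index n u.2)%MM.

Definition conv_poly (S : comNzRingType) (h : S) (WV : 'M[S]_(D, dv))
    (kern : 'M[S]_(s, dv)) (i : 'I_N) (j : 'I_dv) : {mpoly S[N * D]} :=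
  sum_monomials (conv_coef h WV kern j) (conv_sel i) conv_monomial.

(** The common variable of token [i] cancels. A variable of token [n] remains, and it must be one of
    the two remaining variables on the other side, both of token [n']. *)
Lemma attn_monomial_inj i u : injective (attn_monomial i u).
Proof.
move=> n n' /addmI /mnmP /(_ (mxvec_index n u.1.2)).
rewrite !mnmDE !mnm1E eqxx.
have [/mxvec_index_inj[] //|_] := eqVneq (mxvec_index n' u.1.2).
by have [/mxvec_index_inj[] //|_] := eqVneq (mxvec_index n' u.2).
Qed.

Lemma conv_monomial_inj u : injective (conv_monomial u).
Proof.
move=> n n' /mnmP /(_ (mxvec_index n u.2)); rewrite !mnm1E eqxx.
by case: eqP => // /mxvec_index_inj[->].
Qed.

Lemma attn_poly_homog (S : comNzRingType) (p : S) WQ WK WV i j :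
  attn_poly p WQ WK WV i j \is 3.-homog.
Proof. by apply: sum_monomials_homog => u n; rewrite !mdegD !mdeg1. Qed.

Lemma conv_poly_homog (S : comNzRingType) (h : S) WV kern i j :
  conv_poly h WV kern i j \is 1.-homog.
Proof. by apply: sum_monomials_homog => u n; rewrite mdeg1. Qed.

Lemma map_attn_poly (S S' : comNzRingType) (f : {rmorphism S -> S'})
    (p : S) WQ WK WV i j :
  map_mpoly f (attn_poly p WQ WK WV i j) =
  attn_poly (f p) (map_mx f WQ) (map_mx f WK) (map_mx f WV) i j.
Proof.
rewrite map_sum_monomials; apply: eq_sum_monomials => u /=.
rewrite /attn_coef rmorphM rmorph_sum; congr (_ * _); apply: eq_bigr => k _.
by rewrite !rmorphM !mxE.
Qed.

Lemma map_conv_poly (S S' : comNzRingType) (f : {rmorphism S -> S'})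
    (h : S) WV kern i j :
  map_mpoly f (conv_poly h WV kern i j) =
  conv_poly (f h) (map_mx f WV) (map_mx f kern) i j.
Proof.
rewrite map_sum_monomials; apply: eq_sum_monomials => u /=.
by rewrite /conv_coef rmorphM !mxE; case: u.1 => [t|] //; rewrite mxE.
Qed.

Lemma attn_poly_represents (R : realType) (WQ WK : 'M[R]_(D, dk)) WV i j :
  represents (attn_poly pi^-1 WQ WK WV i j)
    (fun X => castling_attn WQ WK WV X i j).
Proof.
move=> X; rewrite meval_sum_monomials /castling_attn !mxE.
under [RHS]eq_bigr do rewrite /attn_coef -mulrA.
rewrite -mulr_sumr; congr (_ * _).
(* Both sides are compared with the full expansion over channel triples, inner index [k] and tokens
   [n]. *)
transitivity (\sum_(u : 'I_D * 'I_D * 'I_D) \sum_(k < dk) \sum_(n < N)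
    (X i u.1.1 * WQ u.1.1 k) * ((X n u.1.2 * WK u.1.2 k) * (X n u.2 * WV u.2 j))).
  rewrite exchange_big; apply: eq_bigr => k _.
  under [RHS]eq_bigr do rewrite -mulr_sumr.
  rewrite -(pair_bigA _ (fun u c => X i u.1 * WQ u.1 k *
    \sum_n X n u.2 * WK u.2 k * (X n c * WV c j))) /=.
  rewrite -(pair_bigA _ (fun a b => \sum_c X i a * WQ a k *
    \sum_n X n b * WK b k * (X n c * WV c j))) /= !mxE mulr_suml.
  apply: eq_bigr => a _.
  under [RHS]eq_bigr do rewrite -mulr_sumr.
  rewrite -mulr_sumr; congr (_ * _).
  under [RHS]eq_bigr do rewrite exchange_big.
  rewrite exchange_big; apply: eq_bigr => n _.
  rewrite !mxE mulr_suml; apply: eq_bigr => b _.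
  by rewrite mulr_sumr.
apply: eq_bigr => u _; rewrite mulr_suml; apply: eq_bigr => k _.
rewrite mulr_sumr; apply: eq_bigr => n _.
rewrite /attn_monomial !mpolyXD !mevalM !mevalXU !mxvecE.
by ring.
Qed.

Lemma conv_poly_represents (R : realType) (WV : 'M[R]_(D, dv)) kern i j :
  represents (conv_poly 2^-1 WV kern i j)
    (fun X => castling_conv pos off WV kern X i j).
Proof.
move=> X; rewrite meval_sum_monomials /castling_conv mxE mul_scalar_mx !mxE.
rewrite -(pair_bigA _ (fun o c => conv_coef 2^-1 WV kern j (o, c) *
  \sum_(n | conv_sel i (o, c) n) ('X_[R, conv_monomial (o, c) n]).@[mxvec X 0])) /=.
have term c n : ('X_[R, conv_monomial c n]).@[mxvec X 0] = X n c.2.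
  by rewrite mevalXU mxvecE.
(* The index [None] yields the term with factor 1/2; the remaining ones are reindexed by the
   taps. *)
rewrite (bigD1 None) //=; congr (_ + _).
  rewrite mulr_sumr; apply: eq_bigr => c _.
  by rewrite big_pred1_eq term /conv_coef /= -mulrA [WV _ _ * _]mulrC.
rewrite (reindex_omap Some id) => [|[t|]] //=.
apply: eq_big => [t|t _]; first by rewrite ?eqxx.
under eq_bigr do rewrite mxE.
rewrite exchange_big mulr_sumr; apply: eq_bigr => c _ /=.
under [in RHS]eq_bigr do rewrite term.
by rewrite -mulr_suml /conv_coef /=; ring.
Qed.

(** Read off the polynomial form: every monomial is a single variable, whose value is linear in
    X. *)
Lemma conv_linear (R : realType) (WV : 'M[R]_(D, dv)) kern :
  linear_fun (castling_conv pos off WV kern).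
Proof.
move=> i j a X Y; rewrite !conv_poly_represents !meval_sum_monomials.
rewrite mulr_sumr -big_split; apply: eq_bigr => u _ /=.
rewrite mulrCA -mulrDr; congr (_ * _).
rewrite mulr_sumr -big_split; apply: eq_bigr => n _ /=.
by rewrite !mevalXU linearP !mxE.
Qed.

End CastlingPolynomials.

(** * Weights as variables, and linear-time programs for coefficients and output *)

Section CastlingScheme.

Variables (G : zmodType) (D dk dv s : nat).
Local Notation q := (D * dk + (D * dk + (D * dv + s * dv)))%N.

Definition weights_Q (S : Type) (w : 'rV[S]_q) : 'M[S]_(D, dk) :=
  vec_mx (lsubmx w).
Definition weights_K (S : Type) (w : 'rV[S]_q) : 'M[S]_(D, dk) :=
  vec_mx (lsubmx (rsubmx w)).
Definition weights_V (S : Type) (w : 'rV[S]_q) : 'M[S]_(D, dv) :=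
  vec_mx (lsubmx (rsubmx (rsubmx w))).
Definition weights_kern (S : Type) (w : 'rV[S]_q) : 'M[S]_(s, dv) :=
  vec_mx (rsubmx (rsubmx (rsubmx w))).

(** Universal weights: polynomials built from them specialise, by evaluation at [w], to those built
    from [w]. *)
Definition generic_weights (S : comNzRingType) : 'rV[{mpoly S[q]}]_q :=
  \row_k 'X_k.

Lemma map_generic_weights (S : comNzRingType) (w : 'rV[S]_q) :
  map_mx (meval (w 0)) (generic_weights S) = w.
Proof. by apply/rowP => k; rewrite !mxE mevalXU. Qed.

Variables (R : realType) (pos : forall N : nat, 'I_N -> G) (off : 'I_s -> G).

Definition castling_poly : poly_scheme R (fun=> castling_nweights D dk dv s) D dv :=
  fun N i j =>
    let w := generic_weights R in
    attn_poly (pi^-1)%:MP (weights_Q w) (weights_K w) (weights_V w) i j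
    + conv_poly (@pos N) off (2^-1)%:MP (weights_V w) (weights_kern w) i j.

Lemma castling_poly_represents (N : nat) (w : 'rV[R]_q) i j :
  represents (at_weights w (castling_poly i j))
    (fun X => @castling_scheme R G D dk dv s pos off N w X i j).
Proof.
move=> X; rewrite /at_weights /castling_poly rmorphD /=.
rewrite map_attn_poly map_conv_poly /= !mevalC.
rewrite /weights_Q /weights_K /weights_V /weights_kern.
rewrite !map_vec_mx !(map_lsubmx, map_rsubmx) map_generic_weights.
rewrite mevalD -attn_poly_represents -conv_poly_represents.
by rewrite /castling_scheme /castling mxE.
Qed.

Lemma castling_coefs_linear_time : coefs_linear_time castling_poly.
Proof.
pose w := generic_weights R.
(* All candidate coefficients: an output channel, a subset of the cubic indices and a subset of the
   linear ones. This index type does not mention N. *)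
pose coef (x : 'I_dv * {ffun 'I_D * 'I_D * 'I_D -> bool}
                 * {ffun option 'I_s * 'I_D -> bool}) :=
  \sum_(u | x.1.2 u)
     attn_coef (pi^-1)%:MP (weights_Q w) (weights_K w) (weights_V w) x.1.1 u
  + \sum_(u | x.2 u) conv_coef (2^-1)%:MP (weights_V w) (weights_kern w) x.1.1 u.
have [prog progP] := finite_family_computable coef.
exists (size prog) => -[|N].
  (* For N = 0 the bound forces the empty program, and there is no entry to treat; for N > 0 a
     constant length is at most linear. *)
  by exists [::] => // -[].
exists prog => [|i j m _]; first by rewrite leq_pmulr.
have [e1 e1P] := mcoeff_sum_monomials (fun _ _ => true)
  (attn_coef (pi^-1)%:MP (weights_Q w) (weights_K w) (weights_V w) j) m
  (attn_monomial_inj (i := i)).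
have [e2 e2P] := mcoeff_sum_monomials (conv_sel (@pos N.+1) off i)
  (conv_coef (2^-1)%:MP (weights_V w) (weights_kern w) j) m
  (@conv_monomial_inj _ _ _).
have [cell cellP] := progP (j, e1, e2); exists cell => w0.
by rewrite cellP /coef /= -e1P -e2P -mcoeffD.
Qed.

Lemma castling_output_linear_time (pos_inj : forall N : nat, injective (@pos N)) :
  output_linear_time (@castling_scheme R G D dk dv s pos off).
Proof.
(* Costs per token. An entry of Q, K or V takes D products, D additions and a constant 0. An entry
   of K^T V takes 2N + 1 instructions, at most 3N when N > 0. In [cO] a tap takes 4: two for its
   inner sum, a product by the kernel and an addition. *)
pose cQKV := ((dk + dk + dv) * (D * 2).+1)%N.
pose cKV := (dk * dv * 3)%N.
pose cO := ((1 + (dk * 2).+1).+1 + ((1 + 0).+1 + (s * 4).+1).+1).+1.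
exists (cQKV + cKV + dv * cO)%N => -[|N].
  by exists [::] => //; exists (fun _ _ => 0%N) => w X [].
set p := pos (N := N.+1).
pose T : Type := ('rV[R]_q * 'M[R]_(N.+1, D))%type.
pose mem (t : T) := row_seq (row_mx t.1 (mxvec t.2)).
have size_mem (t : T) : size (mem t) = (q + N.+1 * D)%N by rewrite size_row_seq.
pose within := @computable_within R T (q + N.+1 * D)%N mem.
have in_w prog k : within prog 0%N (fun t => t.1 0 k).
  apply: within_computed => //.
  rewrite -(cat0s prog); apply: computed_cat => //.
  have [i lt_i iE] := computed_input
    (fun t : T => row_mx t.1 (mxvec t.2)) (lshift _ k).
  by exists i => // t; rewrite iE row_mxEl.
have in_X prog i a : within prog 0%N (fun t => t.2 i a).
  apply: within_computed => //.
  rewrite -(cat0s prog); apply: computed_cat => //.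
  have [k lt_k kE] := computed_input
    (fun t : T => row_mx t.1 (mxvec t.2)) (rshift _ (mxvec_index i a)).
  by exists k => // t; rewrite kE row_mxEr mxvecE.
have in_Q prog a k : within prog 0%N (fun t => weights_Q t.1 a k).
  by apply: within_eq (in_w _ _) => t; rewrite !mxE.
have in_K prog a k : within prog 0%N (fun t => weights_K t.1 a k).
  by apply: within_eq (in_w _ _) => t; rewrite !mxE.
have in_V prog c j : within prog 0%N (fun t => weights_V t.1 c j).
  by apply: within_eq (in_w _ _) => t; rewrite !mxE.
have in_kern prog k j : within prog 0%N (fun t => weights_kern t.1 k j).
  by apply: within_eq (in_w _ _) => t; rewrite !mxE.
have within_mul0 prog k f g : within prog 0%N f -> within prog k g ->
    within prog k.+1 (fun t => f t * g t).
  exact: (within_mul size_mem).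
have proj e (W : T -> 'M[R]_(D, e)) i k :
    (forall a, within [::] 0%N (fun t => W t a k)) ->
  within [::] (D * 2).+1 (fun t => (t.2 *m W t) i k).
  move=> WP.
  apply: (within_eq (f := fun t : T => \sum_a t.2 i a * W t a k)) => [t|].
    by rewrite mxE.
  by apply: (within_sum_ord size_mem) => a; apply: within_mul0.
pose QKV (x : 'I_N.+1 * ('I_dk + 'I_dk + 'I_dv)) (t : T) :=
  match x.2 with
  | inl (inl k) => (t.2 *m weights_Q t.1) x.1 k
  | inl (inr k) => (t.2 *m weights_K t.1) x.1 k
  | inr j => (t.2 *m weights_V t.1) x.1 j
  end.
have /(within_family size_mem) [prog1 size1 QKV_P] :
    forall x, within [::] (D * 2).+1 (QKV x).
  by case=> n [[k|k]|j]; apply: proj => a.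
rewrite /= in QKV_P.
(* Once [prog1] has run, the entries of Q, K and V are available for free, whatever follows. *)
have inp_Q prog i k : within (prog1 ++ prog) 0%N
    (fun t => (t.2 *m weights_Q t.1) i k).
  by apply/within_computed/computed_cat => //; apply: (QKV_P (i, inl (inl k))).
have inp_K prog i k : within (prog1 ++ prog) 0%N
    (fun t => (t.2 *m weights_K t.1) i k).
  by apply/within_computed/computed_cat => //; apply: (QKV_P (i, inl (inr k))).
have inp_V prog i j : within (prog1 ++ prog) 0%N
    (fun t => (t.2 *m weights_V t.1) i j).
  by apply/within_computed/computed_cat => //; apply: (QKV_P (i, inr j)).
pose KV (t : T) := (t.2 *m weights_K t.1)^T *m (t.2 *m weights_V t.1).
have /(within_family size_mem) [prog2 size2 KV_P] :
    forall x : 'I_dk * 'I_dv, within prog1 (N.+1 * 2).+1 (fun t => KV t x.1 x.2).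
  case=> k j /=; rewrite -[prog1]cats0.
  apply: (within_eq (f := fun t : T => \sum_n
      (t.2 *m weights_K t.1) n k * (t.2 *m weights_V t.1) n j)) => [t|].
    by rewrite [RHS]mxE; apply: eq_bigr => n _; rewrite [in RHS]mxE.
  by apply: (within_sum_ord size_mem) => n; apply: within_mul0.
have inp_KV k j : within (prog1 ++ prog2) 0%N (fun t => KV t k j).
  by apply: within_computed => //; apply: (KV_P (k, j)).
(* Since [pos] is injective the sum has at most one term: one addition and the constant 0. *)
have conv_tap prog i j (u : 'I_s) : within (prog1 ++ prog) 2
    (fun t => \sum_(m < N.+1 | p m == p i - off u) (t.2 *m weights_V t.1) m j).
  have card_le1 : (#|[pred m | p m == (p i - off u)%R]| <= 1)%N.
    by apply/card_le1_eqP => m m' /eqP pm /eqP pm';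
      exact: (@pos_inj N.+1 _ _ (etrans pm' (esym pm))).
  have := within_sum size_mem (P := [pred m | p m == p i - off u])
    (fun m _ => inp_V prog m j).
  by apply: within_leq; rewrite muln1 ltnS.
have /(within_family size_mem) [prog3 size3 out_P] :
    forall x : 'I_N.+1 * 'I_dv, within (prog1 ++ prog2) cO
      (fun t => @castling_scheme R G D dk dv s pos off N.+1 t.1 t.2 x.1 x.2).
  case=> i j /=.
  apply: (within_eq (f := fun t : T =>
    pi^-1 * (\sum_k (t.2 *m weights_Q t.1) i k * KV t k j)
    + (2^-1 * (t.2 *m weights_V t.1) i j
       + \sum_u weights_kern t.1 u j *
           \sum_(m < N.+1 | p m == p i - off u) (t.2 *m weights_V t.1) m j))) => [t|].
    rewrite /castling_scheme /castling /castling_attn /castling_conv.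
    (* Entries are expanded selectively, so that the products already stored in memory stay
       folded. *)
    have addE (A B : 'M[R]_(N.+1, dv)) : (A + B) i j = A i j + B i j.
      by rewrite mxE.
    have scaleE a (A : 'M[R]_(N.+1, dv)) : (a *: A) i j = a * A i j.
      by rewrite mxE.
    rewrite mul_scalar_mx !addE !scaleE.
    by congr (_ * _ + (_ + _)); rewrite [RHS]mxE.
  apply: (within_add size_mem); last apply: (within_add size_mem).
  - apply: (within_mul size_mem (within_const size_mem _ pi^-1)).
    by apply: (within_sum_ord size_mem) => k; apply: within_mul0.
  - exact: (within_mul size_mem (within_const size_mem _ 2^-1) (inp_V _ _ _)).
  by apply: (within_sum_ord size_mem) => u; apply: within_mul0.
exists (prog1 ++ prog2 ++ prog3).
  rewrite !card_prod !card_sum !card_ord in size1 size2 size3.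
  rewrite !size_cat /cQKV /cKV; nia.
have [out _ outP] := fin_all_exists2 out_P.
exists (fun i j => out (i, j)) => w X i j.
by rewrite catA; apply: (outP (i, j) (w, X)).
Qed.

End CastlingScheme.

(** * Degree bounds, and attaining degree 3 exactly *)

Lemma castling_attn_const1 (R : realType) (N D dk dv : nat) (i : 'I_N) (j : 'I_dv) :
    (0 < D)%N -> (0 < dk)%N ->
  castling_attn (const_mx 1 : 'M[R]_(D, dk)) (const_mx 1) (const_mx 1)
    (const_mx 1) i j != 0.
Proof.
move=> D_gt0 dk_gt0; have N_gt0 : (0 < N)%N by case: (N) i => // -[].
have mul_const m n p (a b : R) :
    (const_mx a : 'M_(m, n)) *m (const_mx b : 'M_(n, p)) = const_mx (a * b *+ n).
  apply/matrixP => k l; rewrite !mxE.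
  under eq_bigr do rewrite !mxE.
  by rewrite sumr_const card_ord.
(* The entry equals dk N D^3 / pi, and N > 0 because [i] exists. *)
rewrite /castling_attn !mul_const trmx_const !mul_const !mxE.
apply: mulf_neq0; first by rewrite invr_eq0 gt_eqF ?pi_gt0.
rewrite !(mulf_eq0, mulrn_eq0, oner_eq0) !orbF !eqn0Ngt.
by rewrite D_gt0 dk_gt0 N_gt0.
Qed.

(** Only an inequality, because 0 is homogeneous of every degree and has [msize] 0. *)
Lemma msize_homog_le (R : nzRingType) n d (p : {mpoly R[n]}) :
  p \is d.-homog -> (msize p <= d.+1)%N.
Proof.
move=> /dhomogP hom_p; rewrite msizeE big_seq.
by apply/bigmax_leqP_seq => m m_p _; rewrite hom_p.
Qed.

(** The leading monomial of [p] has degree [d], and [r], of degree below [d], cannot cancel it. *)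
Lemma msize_homogD (R : nzRingType) n d (p r : {mpoly R[n]}) :
    p \is d.-homog -> p != 0 -> (msize r <= d)%N ->
  msize (p + r) = d.+1.
Proof.
move=> hom_p p_neq0 le_r; apply/eqP; rewrite eqn_leq; apply/andP; split.
  rewrite (leq_trans (msizeD_le _ _)) // geq_max msize_homog_le //=.
  exact: leq_trans le_r _.
have deg_m : mdeg (mlead p) = d := dhomog_mf hom_p (mlead_supp p_neq0).
rewrite -{1}deg_m; apply: msize_mdeg_lt; rewrite mcoeff_msupp mcoeffD.
have /memN_msupp_eq0 -> : mlead p \notin msupp r.
  by apply: msize_mdeg_ge; rewrite deg_m.
by rewrite addr0 -mcoeff_msupp mlead_supp.
Qed.

Theorem mainTheorem7 (R : realType) (D dk dv s : nat) (G : zmodType)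
    (pos : forall N : nat, 'I_N -> G) (off : 'I_s -> G)
    (pos_inj : forall N : nat, injective (pos N)) :
  [/\ forall (N : nat) (WQ WK : 'M[R]_(D, dk)) (WV : 'M[R]_(D, dv))
             (kern : 'M[R]_(s, dv)),
        [/\ homog_poly_fun 3 (fun X : 'M[R]_(N, D) => castling_attn WQ WK WV X),
            linear_fun (fun X : 'M[R]_(N, D) => castling_conv (pos N) off WV kern X)
          & poly_fun_deg_le 3
              (fun X : 'M[R]_(N, D) => castling (pos N) off WQ WK WV kern X)],
      (0 < D)%N -> (0 < dk)%N -> forall N : nat,
        exists (WQ WK : 'M[R]_(D, dk)) (WV : 'M[R]_(D, dv)),
          forall kern : 'M[R]_(s, dv),
            poly_fun_deg_eq 3
              (fun X : 'M[R]_(N, D) => castling (pos N) off WQ WK WV kern X),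
      output_linear_time (@castling_scheme R G D dk dv s pos off)
    & PADRe (@castling_scheme R G D dk dv s pos off)].
Proof.
have castling_poly_fun N (WQ WK : 'M[R]_(D, dk)) (WV : 'M[R]_(D, dv)) kern i j :
    represents (attn_poly pi^-1 WQ WK WV i j + conv_poly (pos N) off 2^-1 WV kern i j)
      (fun X => castling (pos N) off WQ WK WV kern X i j).
  move=> X; rewrite mevalD -attn_poly_represents -conv_poly_represents.
  by rewrite /castling mxE.
have conv_size N (WV : 'M[R]_(D, dv)) kern i j :=
  msize_homog_le (conv_poly_homog (pos N) off 2^-1 WV kern i j).
split.
- move=> N WQ WK WV kern; split; last 1 first.
  + move=> i j; eexists; last exact: castling_poly_fun.
    rewrite (leq_trans (msizeD_le _ _)) // geq_max.
    by rewrite msize_homog_le ?attn_poly_homog // (leq_trans (conv_size _ _ _ _ _)).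
  + move=> i j; exists (attn_poly pi^-1 WQ WK WV i j).
      exact: attn_poly_homog.
    exact: attn_poly_represents.
  exact: conv_linear.
- move=> D_gt0 dk_gt0 N.
  (* With all-ones weights the cubic part is nonzero at the all-ones input; the kernel enters only
     the linear part and stays arbitrary. *)
  exists (const_mx 1), (const_mx 1), (const_mx 1) => kern i j.
  eexists; last exact: castling_poly_fun.
  apply: msize_homogD; first exact: attn_poly_homog.
    apply/eqP => attn0.
    have := castling_attn_const1 R i j D_gt0 dk_gt0.
    by rewrite attn_poly_represents attn0 meval0 eqxx.
  exact: leq_trans (conv_size _ _ _ _ _) _.
- exact: castling_output_linear_time.
exists (@castling_poly G D dk dv s R pos off); split.
- exact: castling_poly_represents.
- exact: castling_coefs_linear_time.
exact: castling_output_linear_time.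
Qed.
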